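(* Let $G$ be a virtually RFRS group. Then $G$ does not contain a subgroup that is a nonabelian torsion-free nilpotent group.
   Context: A group $G$ is called residually finite rationally solvable, or RFRS, if there exists an exhaustive filtration (i.e. $\bigcap_i G_i=\{1\}$) of subgroups $G=G_0>G_1>G_2>\cdots$, each $G_i$ being normal in $G$ and of finite index in $G$, such that for every $i\ge 0$ one has $G_{i+1}>\ker\{G_i\to G_i^{ab}\otimes\mathbb{Q}\}$. Here $>$ denotes containment as a subgroup, $G_i^{ab}$ is the abelianization of $G_i$, and $G_i\to G_i^{ab}\otimes\mathbb{Q}$ is the natural map. A group is virtually RFRS if it has a finite index subgroup that is RFRS. *)

(* Defs.v *)
From HB Require Import structures.
From mathcomp Require Import all_boot all_order all_algebra.
From mathcomp Require Import boolp classical_sets cardinality.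
From mathcomp.multinomials Require Import freeg.

Set Implicit Arguments.
Unset Strict Implicit.
Unset Printing Implicit Defensive.

Local Open Scope classical_set_scope.
Local Open Scope group_scope.
Local Open Scope quotient_scope.

(* A group is a [groupType] and a subgroup of G is a [groupClosed G], i.e. a
   boolean predicate on G that is closed under the group operations.  Boolean
   predicates lose no generality here: by [boolp.asbool] every Prop-valued
   predicate has a boolean counterpart, and every type has an [eqType] and a
   [choiceType] structure. *)

Section SubgroupType.
Variables (G : groupType) (H : groupClosed G).

Definition subgroup_type : Type := {x : G | x \in H}.

Lemma subgroup_closed : group_closed (H : {pred G}).
Proof. by split; [exact: gpred1 | move=> x y; exact: gpredF]. Qed.

HB.instance Definition _ := SubChoice.on subgroup_type.
HB.instance Definition _ :=
  SubChoice_isSubGroup.Build G (fun x => x \in H) subgroup_type subgroup_closed.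

End SubgroupType.

Section WholeGroup.
Variable G : groupType.

Definition whole_group : {pred G} := predT.

Let whole_group1 : 1 \in whole_group. Proof. by []. Qed.
Let whole_groupM : mulg_closed whole_group. Proof. by []. Qed.
Let whole_groupV : invg_closed whole_group. Proof. by []. Qed.

HB.instance Definition _ := isMulClosed.Build G whole_group whole_groupM.
HB.instance Definition _ := isMul1Closed.Build G whole_group whole_group1.
HB.instance Definition _ := isInvClosed.Build G whole_group whole_groupV.

End WholeGroup.

Section GeneratedSubgroup.
Variables (G : groupType) (S : set G).

Definition generated : {pred G} := fun x =>
  `[< forall K : groupClosed G, (forall s, S s -> s \in K) -> x \in K >].

Let generated1 : 1 \in generated.
Proof. by apply/asboolP => K _; exact: gpred1. Qed.
Let generatedM : mulg_closed generated.
Proof.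
move=> x y /asboolP gx /asboolP gy; apply/asboolP => K SK.
by apply: gpredM; [exact: gx | exact: gy].
Qed.
Let generatedV : invg_closed generated.
Proof.
by move=> x /asboolP gx; apply/asboolP => K SK; apply: gpredVr; exact: gx.
Qed.

HB.instance Definition _ := isMulClosed.Build G generated generatedM.
HB.instance Definition _ := isMul1Closed.Build G generated generated1.
HB.instance Definition _ := isInvClosed.Build G generated generatedV.

Lemma mem_generated x : S x -> x \in generated.
Proof. by move=> Sx; apply/asboolP => K; apply. Qed.

End GeneratedSubgroup.

Section GroupNotions.
Variable G : groupType.
Implicit Types H K : groupClosed G.

Local Notation G1 := (GroupClosed.clone G (@whole_group G) _).

Definition commutator_subgroup H K : groupClosed G :=
  GroupClosed.clone G
    (generated [set z | exists x y, [/\ x \in H, y \in K & z = [~ x, y]]]) _.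

Definition derived_subgroup : groupClosed G :=
  commutator_subgroup G1 G1.

Fixpoint lower_central (n : nat) : groupClosed G :=
  if n is m.+1 then commutator_subgroup (lower_central m) G1
  else G1.

Definition is_nilpotent : Prop :=
  exists n, forall x, x \in lower_central n -> x = 1.

Definition is_torsion_free : Prop :=
  forall (x : G) (n : nat), (0 < n)%N -> x ^+ n = 1 -> x = 1.

Definition is_abelian : Prop := forall x y : G, commute x y.

Definition is_normal H : Prop := forall x y : G, x \in H -> x ^ y \in H.

Definition left_coset H (x : G) : set G := [set x * h | h in [set` H]].

Definition finite_index H : Prop := finite_set (range (left_coset H)).

End GroupNotions.

Section Abelianization.
Variable G : groupType.

Local Notation D := (derived_subgroup G).

Lemma mem_commg (x y : G) : [~ x, y] \in D.
Proof. by apply: mem_generated; exists x, y. Qed.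

Lemma derivedJ (x y : G) : x \in D -> x ^ y \in D.
Proof. by move=> Dx; rewrite -(mulVKg x (x ^ y)) gpredM // mem_commg. Qed.

(* The quotient of G by its derived subgroup, written additively. *)
Definition abel_equiv (x y : G) : bool := x^-1 * y \in D.

Lemma abel_equiv_is_equiv : equiv_class_of abel_equiv.
Proof.
split=> [x|x y|y x z]; rewrite /abel_equiv.
- by rewrite mulVg gpred1.
- by rewrite -gpredV invgM invgK.
- by move=> xy yz; rewrite -(mulVKg y z) mulgA gpredM.
Qed.

Canonical abel_equiv_equiv := EquivRelPack abel_equiv_is_equiv.
Canonical abel_equiv_encModRel := defaultEncModRel abel_equiv.

Definition abelianization : Type := {eq_quot abel_equiv}.

HB.instance Definition _ : EqQuotient G abel_equiv abelianization :=
  EqQuotient.on abelianization.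
HB.instance Definition _ := Choice.on abelianization.

Definition to_abel (x : G) : abelianization := \pi_abelianization x.

Lemma to_abelP (x y : G) : reflect (to_abel x = to_abel y) (x^-1 * y \in D).
Proof. exact: eqmodP. Qed.

Definition abel_zero : abelianization := to_abel 1.
Definition abel_add (u v : abelianization) : abelianization :=
  to_abel (repr u * repr v).
Definition abel_opp (u : abelianization) : abelianization :=
  to_abel (repr u)^-1.

Lemma to_abel_repr u : to_abel (repr u) = u.
Proof. exact: reprK. Qed.

Lemma repr_to_abel x : (repr (to_abel x))^-1 * x \in D.
Proof. by apply/to_abelP; rewrite to_abel_repr. Qed.

Lemma abel_addE x y : abel_add (to_abel x) (to_abel y) = to_abel (x * y).
Proof.
apply/to_abelP; set x' := repr _; set y' := repr _.
have -> : (x' * y')^-1 * (x * y) = (x'^-1 * x) ^ y' * (y'^-1 * y).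
  by rewrite /conjg invgM !mulgA mulgK.
by rewrite gpredM ?derivedJ ?repr_to_abel.
Qed.

Lemma abel_oppE x : abel_opp (to_abel x) = to_abel x^-1.
Proof.
apply/to_abelP; set x' := repr _; rewrite invgK.
have -> : x' * x^-1 = (x^-1 * x') ^ x^-1 by rewrite /conjg invgK !mulgA mulgV mul1g.
by apply: derivedJ; rewrite -gpredV invgM invgK repr_to_abel.
Qed.

Lemma abel_addA : associative abel_add.
Proof.
by move=> u v w; rewrite -(to_abel_repr u) -(to_abel_repr v) -(to_abel_repr w)
  !abel_addE mulgA.
Qed.

Lemma abel_addC : commutative abel_add.
Proof.
move=> u v; apply/to_abelP.
have -> : (repr u * repr v)^-1 * (repr v * repr u) = [~ repr v, repr u].
  by rewrite /commg /conjg invgM !mulgA.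
exact: mem_commg.
Qed.

Lemma abel_add0 : left_id abel_zero abel_add.
Proof. by move=> u; rewrite -(to_abel_repr u) abel_addE mul1g. Qed.

Lemma abel_addN : left_inverse abel_zero abel_opp abel_add.
Proof.
by move=> u; rewrite -(to_abel_repr u) abel_oppE abel_addE mulVg.
Qed.

HB.instance Definition _ := GRing.isZmodule.Build abelianization
  abel_addA abel_addC abel_add0 abel_addN.

Lemma to_abelM x y : to_abel (x * y) = (to_abel x + to_abel y)%R.
Proof. by rewrite -abel_addE. Qed.

End Abelianization.

Section GeneratedZmodule.
Import GRing.Theory.
Local Open Scope ring_scope.
Variables (V : zmodType) (S : set V).

Definition zgenerated : {pred V} := fun x =>
  `[< forall K : zmodClosed V, (forall s, S s -> s \in K) -> x \in K >].

Let zgeneratedB : zmod_closed zgenerated.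
Proof.
split=> [|x y /asboolP gx /asboolP gy]; apply/asboolP => K SK.
  exact: rpred0.
by apply: rpredB; [exact: gx | exact: gy].
Qed.

HB.instance Definition _ := GRing.isZmodClosed.Build V zgenerated zgeneratedB.

Lemma mem_zgenerated x : S x -> x \in zgenerated.
Proof. by move=> Sx; apply/asboolP => K; apply. Qed.

End GeneratedZmodule.

(* A \otimes_Z B: the free abelian group on the set A * B modulo the subgroup
   generated by the additivity relations in each variable. *)
Section TensorProduct.
Import GRing.Theory.
Local Open Scope ring_scope.
Variables A B : zmodType.

Definition free_tensor (a : A) (b : B) : {freeg (A * B)} :=
  [freeg [:: (1%Z, (a, b))]].

Definition tensor_relations : set {freeg (A * B)} :=
  [set r | (exists a a' b,
      r = free_tensor (a + a') b - free_tensor a b - free_tensor a' b) \/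
    (exists a b b',
      r = free_tensor a (b + b') - free_tensor a b - free_tensor a b')].

Definition tensor : Type :=
  Quotient.quot
    (GRing.ZmodClosed.clone {freeg (A * B)} (zgenerated tensor_relations) _).

HB.instance Definition _ := GRing.Zmodule.on tensor.

Definition tens (a : A) (b : B) : tensor := \pi_tensor (free_tensor a b).

Lemma tensDl a a' b : tens (a + a') b = tens a b + tens a' b.
Proof.
rewrite -[RHS]raddfD; apply/eqmodP; rewrite /= Quotient.equivE opprD addrA.
by apply: mem_zgenerated; left; exists a, a', b.
Qed.

Lemma tensDr a b b' : tens a (b + b') = tens a b + tens a b'.
Proof.
rewrite -[RHS]raddfD; apply/eqmodP; rewrite /= Quotient.equivE opprD addrA.
by apply: mem_zgenerated; right; exists a, b, b'.
Qed.

End TensorProduct.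

Definition to_abel_rat (G : groupType) (x : G) :
    tensor (abelianization G) rat :=
  tens (to_abel x) 1%R.

Definition is_rfrs (G : groupType) : Prop :=
  exists F : nat -> groupClosed G,
    [/\ forall x, x \in F 0%N,
        forall i, {subset F i.+1 <= F i},
        forall i, is_normal (F i) /\ finite_index (F i),
        forall x, (forall i, x \in F i) -> x = 1
      & forall i (x : subgroup_type (F i)),
          to_abel_rat x = 0%R -> \val x \in F i.+1].

Definition is_virtually_rfrs (G : groupType) : Prop :=
  exists H : groupClosed G, finite_index H /\ is_rfrs (subgroup_type H).

(* Main.v *)
Require Import Defs.
From mathcomp Require Import all_boot all_algebra.
From mathcomp Require Import boolp classical_sets cardinality.

(** The obstruction is a Heisenberg pair: two elements x and y whose commutator
    z = [~ x, y] commutes with both of them, so that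
    [~ x ^+ k, y ^+ l] = z ^+ (k * l) for all k and l ([commXXg_central]).

    A nonabelian nilpotent group contains such a pair with z != 1, just below
    the end of its lower central series ([nilpotent_nonabelian_commg]).  If the
    group is also torsion-free, then suitable powers of x and y form such a pair
    inside a given subgroup of finite index, still with nontrivial commutator.

    On the other hand z = 1 for every such pair in an RFRS group
    ([rfrs_commg1]): if z lies in a term F i of the filtration, then, F i being
    of finite index, it contains powers x ^+ k and y ^+ l with k, l > 0, whence
    z ^+ (k * l) is a commutator of elements of F i.  So z is torsion in the
    abelianization of F i, it dies rationally ([to_abel_rat_torsion]), and hence
    z lies in F i.+1.  By induction z lies in every term of the filtration. *)

Local Open Scope classical_set_scope.
Local Open Scope group_scope.

Lemma commXg_central (G : groupType) (x y : G) (k : nat) :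
  commute x [~ x, y] -> [~ x ^+ k, y] = [~ x, y] ^+ k.
Proof.
move=> cxz; rewrite commgEl conjXg.
have -> : x ^ y = x * [~ x, y] by rewrite commgEl mulVKg.
by rewrite expgMn // mulKg.
Qed.

Lemma commgX_central (G : groupType) (x y : G) (l : nat) :
  commute y [~ x, y] -> [~ x, y ^+ l] = [~ x, y] ^+ l.
Proof.
move=> cyz; rewrite -[LHS]invgR commXg_central -?expVgn -invgR ?invgK //.
exact: commuteV.
Qed.

Lemma commXXg_central (G : groupType) (x y : G) (k l : nat) :
  commute x [~ x, y] -> commute y [~ x, y] ->
  [~ x ^+ k, y ^+ l] = [~ x, y] ^+ (k * l).
Proof.
move=> cxz cyz; rewrite expgnA -commXg_central // commgX_central //.
by rewrite commXg_central //; exact: commuteX.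
Qed.

(** Pigeonhole: two of the cosets x ^+ n H coincide, and the quotient of the
    corresponding powers is a positive power of x in H. *)
Lemma finite_index_expg {G : groupType} {H : groupClosed G} (x : G) :
  finite_index H -> exists2 k : nat, (0 < k)%N & x ^+ k \in H.
Proof.
move=> finH; apply: contrapT => no_power.
pose f n := left_coset H (x ^+ n).
have expgH m n : (m < n)%N -> f m <> f n.
  move=> ltmn fmn; apply: no_power; exists (n - m)%N; first by rewrite subn_gt0.
  have : f n (x ^+ n) by exists 1; [exact: gpred1 | rewrite mulg1].
  rewrite -fmn => -[h /= Hh] /esym; rewrite -(subnKC (ltnW ltmn)) expgnDr.
  by move=> /mulgI; rewrite addnC addnK => ->.
apply: infinite_nat; have <- : f @^-1` range (left_coset H) = setT.
  by apply/seteqP; split=> // n _; exists (x ^+ n).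
apply: finite_preimage finH => m n _ _ fmn.
by have [/expgH|/expgH/(_ (esym fmn))|] := ltngtP m n.
Qed.

Lemma tens0l (A B : zmodType) (b : B) : tens (0 : A)%R b = 0%R.
Proof. by apply: (@GRing.addrI _ (tens 0%R b)); rewrite -tensDl !GRing.addr0. Qed.

Lemma tens0r (A B : zmodType) (a : A) : tens a (0 : B)%R = 0%R.
Proof. by apply: (@GRing.addrI _ (tens a 0%R)); rewrite -tensDr !GRing.addr0. Qed.

(** Integers slide across the tensor sign; this is what makes tensoring with
    the divisible group rat kill torsion. *)
Lemma tensMn (A B : zmodType) (a : A) (b : B) (n : nat) :
  tens (a *+ n)%R b = tens a (b *+ n)%R.
Proof.
elim: n => [|n IHn]; first by rewrite !GRing.mulr0n tens0l tens0r.
by rewrite !GRing.mulrS tensDl tensDr IHn.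
Qed.

Lemma to_abelX (G : groupType) (x : G) (n : nat) :
  to_abel (x ^+ n) = (to_abel x *+ n)%R.
Proof. by elim: n => // n IHn; rewrite expgS GRing.mulrS to_abelM IHn. Qed.

(** If a = to_abel x satisfies n a = 0, then a (x) 1 = a (x) n (1/n)
    = n a (x) 1/n = 0. *)
Lemma to_abel_rat_torsion (G : groupType) (x : G) (n : nat) :
  (0 < n)%N -> x ^+ n \in derived_subgroup G -> to_abel_rat x = 0%R.
Proof.
move=> n0 Dxn; rewrite /to_abel_rat.
have -> : (1 = (n%:R^-1 *+ n) :> rat)%R.
  by rewrite -[RHS]GRing.mulr_natl GRing.mulfV // Num.Theory.pnatr_eq0 -lt0n.
have xn0 : to_abel (x ^+ n) = 0%R by apply/esym/to_abelP; rewrite invg1 mul1g.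
by rewrite -tensMn -to_abelX xn0 tens0l.
Qed.

(** Take x in the last term of the lower central series that is not central:
    every commutator [~ x, y] is then in the next term, which is central, and
    some [~ x, y] is nontrivial. *)
Lemma nilpotent_nonabelian_commg (N : groupType) :
  is_nilpotent N -> ~ is_abelian N ->
  exists x y : N,
    [/\ [~ x, y] != 1, commute x [~ x, y] & commute y [~ x, y]].
Proof.
move=> [c Lc] nabN.
pose P n := exists x y : N, x \in lower_central N n /\ [~ x, y] != 1.
have P0 : P 0%N.
  apply: contrapT => nP; apply: nabN => x y; apply/commgP/negPn/negP => nxy.
  by apply: nP; exists x, y.
have nPc : ~ P c by move=> [x [y [/Lc->]]]; rewrite comm1g eqxx.
have [m [x [y [Lx nxy]]] nPm] : exists2 m, P m & ~ P m.+1.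
  apply: contrapT => noP; apply: nPc; elim: c {Lc} => // c IHc.
  by apply: contrapT => nPc; apply: noP; exists c.
have centz t : commute t [~ x, y].
  apply/commute_sym/commgP/negPn/negP => nt; apply: nPm; exists [~ x, y], t.
  by split=> //; apply: mem_generated; exists x, y.
by exists x, y; split.
Qed.

(** The commutator z climbs down the whole filtration: finite index brings some
    power of z into the derived subgroup of F i as soon as z is in F i. *)
Lemma rfrs_commg1 (G : groupType) (x y : G) :
  is_rfrs G -> commute x [~ x, y] -> commute y [~ x, y] -> [~ x, y] = 1.
Proof.
move=> [F [F0 _ Ffin Fcap Fker]] cxz cyz; apply: Fcap => i.
elim: i => // i Fz; have [_ fin] := Ffin i.
have [k k0 Fx] := finite_index_expg x fin.
have [l l0 Fy] := finite_index_expg y fin.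
pose sub (g : G) (Fg : g \in F i) : subgroup_type (F i) := Sub g Fg.
apply: (Fker i (sub _ Fz)); apply: (@to_abel_rat_torsion _ _ (k * l)).
  by rewrite muln_gt0 k0.
have -> : sub _ Fz ^+ (k * l) = [~ sub _ Fx, sub _ Fy].
  by apply: val_inj; rewrite gmulfXn gmulfR /= commXXg_central.
exact: mem_commg.
Qed.

Theorem corollary1p7 (G : groupType) :
  is_virtually_rfrs G ->
  ~ (exists H : groupClosed G,
       [/\ ~ is_abelian (subgroup_type H),
           is_torsion_free (subgroup_type H)
         & is_nilpotent (subgroup_type H)]).
Proof.
move=> [K [finK rfrsK]] [N [nabN tfN nilN]].
have [x [y [nz cxz cyz]]] := nilpotent_nonabelian_commg _ nilN nabN.
have [k k0 Kx] := finite_index_expg (\val x) finK.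
have [l l0 Ky] := finite_index_expg (\val y) finK.
pose x' : subgroup_type K := Sub (\val x ^+ k) Kx; pose y' : subgroup_type K := Sub (\val y ^+ l) Ky.
have zE : [~ x ^+ k, y ^+ l] = [~ x, y] ^+ (k * l) by exact: commXXg_central.
have vz : \val [~ x', y'] = \val [~ x ^+ k, y ^+ l].
  by rewrite !gmulfR !gmulfXn.
(* The powers of x and y commute with their commutator because, in G, the
   latter is the image of a power of [~ x, y]. *)
have comm_pow u m : commute u [~ x, y] -> commute (\val u ^+ m) (\val [~ x', y']).
  by rewrite vz zE -gmulfXn => cuz; apply/gmulf_commute/commuteX2.
have z'1 : [~ x', y'] = 1.
  by apply: rfrs_commg1 => //; apply: val_inj; rewrite !gmulfM; apply: comm_pow.
have z1 : [~ x, y] ^+ (k * l) = 1.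
  by apply: val_inj; rewrite -zE -vz z'1 !gmulf1.
by move/eqP: nz; apply; apply: tfN z1; rewrite muln_gt0 k0.
Qed.
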